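(* Let $\mathcal{L}$ be a finite lattice and $\mathcal{B}$ an $\mathcal{L}$-building set. For any $X\in\mathcal{B}\setminus\kappa(\mathcal{B})$, the link of $\{X\}$ in the $\mathcal{L}$-nested complex of $\mathcal{B}$ is isomorphic to the join of the $\mathcal{L}_{\le X}$-nested complex of $\mathcal{B}_{|X}$ and the $\mathcal{L}_{\ge X}$-nested complex of $\mathcal{B}_{/X}$.
   Context: For a finite lattice $\mathcal{L}$ with bottom $\hat 0$, an $\mathcal{L}$-building set is a subset $\mathcal{B}\subseteq\mathcal{L}_{>\hat 0}$ such that for every $Y\in\mathcal{L}_{>\hat 0}$, with $\{B_1,\dots,B_k\}=\max(\mathcal{B}_{\le Y})$, there is a poset isomorphism $\prod_{j}\mathcal{L}_{\le B_j}\to\mathcal{L}_{\le Y}$ whose $j$-th component is the inclusion. Let $\kappa(\mathcal{B})=\max(\mathcal{B})$ be the set of maximal elements. An $\mathcal{L}$-nested set on $\mathcal{B}$ is a subset $\mathcal{N}\subseteq\mathcal{B}$ containing $\kappa(\mathcal{B})$ such that for any $k\ge2$ pairwise incomparable $B_1,\dots,B_k\in\mathcal{N}\setminus\kappa(\mathcal{B})$, the join $B_1\vee\cdots\vee B_k$ is not in $\mathcal{B}$. The $\mathcal{L}$-nested complex of $\mathcal{B}$ is the simplicial complex with faces $\mathcal{N}\setminus\kappa(\mathcal{B})$ for all $\mathcal{L}$-nested sets $\mathcal{N}$ on $\mathcal{B}$. For $X\in\mathcal{B}$, the restriction is $\mathcal{B}_{|X}=\{B\in\mathcal{B}:B\le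 X\}$, an $\mathcal{L}_{\le X}$-building set, and the contraction is $\mathcal{B}_{/X}=\{B\vee X:B\in\mathcal{B},\ B\not\le X\}$, an $\mathcal{L}_{\ge X}$-building set. The link of a face $\sigma$ in a simplicial complex $\Delta$ is $\{\tau\in\Delta:\sigma\cap\tau=\varnothing,\ \sigma\cup\tau\in\Delta\}$, and the join of $\Delta$ and $\Delta'$ is $\{\sigma\sqcup\sigma':\sigma\in\Delta,\sigma'\in\Delta'\}$. *)

(* Defs.v *)
From HB Require Import structures.
From mathcomp Require Import all_boot all_order.

Set Implicit Arguments.
Unset Strict Implicit.
Unset Printing Implicit Defensive.

Import Order.Theory.
Local Open Scope order_scope.

Section Intervals.
Context {d : Order.disp_t} {L : finTBLatticeType d}.

Definition below_pred (X : L) : {pred L} := fun y => y <= X.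
Definition above_pred (X : L) : {pred L} := fun y => X <= y.

Fact below_meet X : meet_closed (below_pred X).
Proof. by move=> x y; rewrite !unfold_in => hx _; exact: leIxl. Qed.
Fact below_join X : join_closed (below_pred X).
Proof. by move=> x y; rewrite !unfold_in => hx hy; rewrite leUx hx. Qed.
HB.instance Definition _ X :=
  Order.isLatticeClosed.Build d L (below_pred X) (@below_meet X) (@below_join X).

Fact above_meet X : meet_closed (above_pred X).
Proof. by move=> x y; rewrite !unfold_in => hx hy; rewrite lexI hx. Qed.
Fact above_join X : join_closed (above_pred X).
Proof. by move=> x y; rewrite !unfold_in => hx _; exact: lexUl. Qed.
HB.instance Definition _ X :=
  Order.isLatticeClosed.Build d L (above_pred X) (@above_meet X) (@above_join X).

Definition below (X : L) : Type := {y : L | y \in below_pred X}.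
Definition above (X : L) : Type := {y : L | y \in above_pred X}.

HB.instance Definition _ X := SubFinite.on (below X).
HB.instance Definition _ X :=
  [SubChoice_isSubLattice of below X by <: with d].
HB.instance Definition _ X := SubFinite.on (above X).
HB.instance Definition _ X :=
  [SubChoice_isSubLattice of above X by <: with d].

Definition below_bot X : below X := exist _ \bot (le0x X).
Definition below_top X : below X := exist _ X (lexx X).
Definition above_bot X : above X := exist _ X (lexx X).
Definition above_top X : above X := exist _ \top (lex1 X).

Fact below_le0x X (y : below X) : below_bot X <= y.
Proof. by rewrite -Order.le_val le0x. Qed.
Fact below_lex1 X (y : below X) : y <= below_top X.
Proof. by rewrite -Order.le_val; exact: (valP y). Qed.
Fact above_le0x X (y : above X) : above_bot X <= y.
Proof. by rewrite -Order.le_val; exact: (valP y). Qed.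
Fact above_lex1 X (y : above X) : y <= above_top X.
Proof. by rewrite -Order.le_val lex1. Qed.

HB.instance Definition _ X := Order.hasBottom.Build d (below X) (@below_le0x X).
HB.instance Definition _ X := Order.hasTop.Build d (below X) (@below_lex1 X).
HB.instance Definition _ X := Order.hasBottom.Build d (above X) (@above_le0x X).
HB.instance Definition _ X := Order.hasTop.Build d (above X) (@above_lex1 X).

Definition join_above (X y : L) : above X := exist _ (y `|` X) (leUr X y).

End Intervals.

Section Complexes.

(* The void complex (no faces at all) is allowed: it is the link of a
   non-face. *)
Record complex (T : finType) := Complex {
  faces : {set {set T}};
  faces_down : forall s t : {set T}, s \in faces -> t \subset s -> t \in faces
}.

Definition vertices (T : finType) (D : complex T) : {set T} :=
  [set x | [set x] \in faces D].

(* Since [D] is downward closed, its faces are exactly the sets [val @: s],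
   for [s] a set of vertices, that belong to [faces D]. *)
Definition complex_iso (T T' : finType) (D : complex T) (D' : complex T') : Prop :=
  exists f : {x | x \in vertices D} -> {y | y \in vertices D'},
    bijective f /\
    forall s : {set {x | x \in vertices D}},
      ([set val x | x in s] \in faces D) =
      ([set val (f x) | x in s] \in faces D').

Definition link_faces (T : finType) (D : complex T) (s : {set T}) : {set {set T}} :=
  [set t in faces D | (s :&: t == set0) && (s :|: t \in faces D)].

Fact link_down (T : finType) (D : complex T) (s t u : {set T}) :
  t \in link_faces D s -> u \subset t -> u \in link_faces D s.
Proof.
rewrite !inE => /and3P[tD /eqP st0 stD] ut; apply/and3P; split.
- exact: faces_down tD ut.
- by rewrite -subset0 -st0 setIS.
- by apply: faces_down stD _; rewrite setUS.
Qed.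

Definition link (T : finType) (D : complex T) (s : {set T}) : complex T :=
  Complex (@link_down T D s).

Definition join_faces (T T' : finType) (D : complex T) (D' : complex T') :
    {set {set T + T'}} :=
  [set [set inl x | x in s] :|: [set inr y | y in s']
     | s : {set T} in faces D, s' : {set T'} in faces D'].

Fact join_down (T T' : finType) (D : complex T) (D' : complex T')
    (s t : {set T + T'}) :
  s \in join_faces D D' -> t \subset s -> t \in join_faces D D'.
Proof.
case/imset2P=> a b aD bD' -> /subsetP tab.
apply/imset2P; exists (inl @^-1: t) (inr @^-1: t).
- apply: faces_down aD _; apply/subsetP=> x; rewrite inE => /tab.
  rewrite inE => /orP[/imsetP[y ya [->]] //|/imsetP[y _ //]].
- apply: faces_down bD' _; apply/subsetP=> x; rewrite inE => /tab.
  rewrite inE => /orP[/imsetP[y _ //]|/imsetP[y yb [->]] //].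
- apply/setP=> z; rewrite inE; apply/idP/orP.
    by case: z => z zt; [left | right]; apply: imset_f; rewrite inE.
  by case=> /imsetP[y + ->]; rewrite inE.
Qed.

Definition join_complex (T T' : finType) (D : complex T) (D' : complex T') :
    complex (T + T')%type :=
  Complex (@join_down T T' D D').

End Complexes.

Section Nested.
Context {d : Order.disp_t} {L : finTBLatticeType d}.
Implicit Types B N S : {set L}.

Definition kappa B : {set L} :=
  [set b in B | [forall c in B, (b <= c) ==> (c == b)]].

(* The index set of the product is [{b | b \in M}] with M = max(B_{<= Y}). The
   j-th component of [phi] is its restriction to the tuples all of whose other
   entries are \bot. *)
Definition product_iso (Y : L) (M : {set L}) : Prop :=
  exists phi : {dffun forall j : {b : L | b \in M}, below (val j)} -> below Y,
    [/\ bijective phi,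
        forall f g, (phi f <= phi g) = [forall j, f j <= g j]
      & forall (j : {b : L | b \in M}) (x : below (val j)),
          val (phi (finfun (dfwith (fun i : {b : L | b \in M} =>
                                      \bot : below (val i)) x))) = val x].

Definition building_set B : Prop :=
  \bot \notin B /\
  forall Y : L, \bot < Y -> product_iso Y (kappa [set b in B | b <= Y]).

(* Pairwise incomparable elements B_1, ..., B_k are distinct, hence are encoded
   by the set [S] that they form, of cardinal k. *)
Definition nested_set B N : bool :=
  [&& N \subset B, kappa B \subset N
    & [forall S : {set L},
        [&& S \subset N :\: kappa B, (2 <= #|S|)%N
          & [forall x in S, forall y in S, (x != y) ==> (x >< y)]]
        ==> (\join_(x in S) x \notin B)]].

Definition nested_faces B : {set {set L}} :=
  [set N :\: kappa B | N : {set L} & nested_set B N].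

Fact nested_down B (s t : {set L}) :
  s \in nested_faces B -> t \subset s -> t \in nested_faces B.
Proof.
case/imsetP=> N; rewrite inE => /and3P[NB kN /forallP hN] -> ts.
have tE : (t :|: kappa B) :\: kappa B = t.
  rewrite setDUl setDv setU0; apply/setDidPl.
  by rewrite disjoint_sym; apply: disjointWr ts _; rewrite -setI_eq0 setIDA setDIl
     setDv set0I.
apply/imsetP; exists (t :|: kappa B); last by rewrite tE.
rewrite inE; apply/and3P; split; last 1 first.
- apply/forallP=> S; rewrite tE; apply/implyP=> /and3P[St S2 Sa].
  by apply: (implyP (hN S)); rewrite (subset_trans St ts) S2 Sa.
- rewrite subUset (subset_trans ts (subset_trans (subsetDl _ _) NB)).
  exact: subset_trans kN NB.
- exact: subsetUr.
Qed.

Definition nested_complex B : complex L := Complex (@nested_down B).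

Definition restriction B (X : L) : {set below X} := [set b | val b \in B].

Definition contraction B (X : L) : {set above X} :=
  [set join_above X b | b in B & ~~ (b <= X)].

End Nested.

(* Main.v *)
Require Import Defs.
From mathcomp Require Import all_boot all_order.

Set Implicit Arguments.
Unset Strict Implicit.
Unset Printing Implicit Defensive.

Import Order.Theory.
Local Open Scope order_scope.

(** The isomorphism sends a vertex [y] of the link of [{X}] to [y] when
    [y <= X], and to [y `|` X] otherwise ([split_at]).

    The one place where the product decompositions are used is
    [le_join_nested]: if [S] is a nested subset of [B], then an element of [B]
    below the join of [S] is already below some element of [S]. Indeed, let [C]
    be the maximal element of [B] below that join which lies above the given
    element. In the product decomposition, the [C]-coordinate of the join of [S]
    is the join of those elements of [S] that are below [C], and this has to be
    [C] itself. As [C] is in [B] and [S] is nested, [C] belongs to [S].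

    For [S = {X, y}] with [y] compatible with [X] this yields [le_joinX]: an
    element of [B] that is not below [X] but is below [y `|` X] is below [y].
    Hence [y |-> y `|` X] is an order embedding on the compatible elements not
    below [X]. It is onto the contraction, because [b] and [b `|` X] have the
    same image and one of them is compatible. Being an order isomorphism, it
    matches the maximal elements ([kappa_contraction]), so that [split_at] is
    bijective on vertices.

    Faces correspond by [nested_split]. If [X |: N] is nested, and the images of
    some [s] in [N], none below [X], have a join [b `|` X] in the contraction, then
    [le_join_nested] puts [b] below one of these [s], whose image is therefore
    the join. Conversely, suppose that a subset [S] of [X |: N] has its join in
    [B]. If all of [S] is below [X], the restriction decides. Otherwise the
    contraction provides some [y] in [S] with [y `|` X] above the join of [S],
    and then [y] is that join by [le_joinX]. *)

(** * Nested sets and the factors of a building set *)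

Section Nested.
Context {d : Order.disp_t} {L : finTBLatticeType d}.
Implicit Types (B N S : {set L}) (b x y : L).

(** The nested condition with antichains replaced by arbitrary subsets: passing
    to maximal elements changes neither the join nor whether it is attained.
    Comparing two such conditions only requires following joins, and the two
    readings agree as soon as [\bot] is not in [B] ([nested_facesP]). *)
Definition nested B N : Prop :=
  forall S, S \subset N -> \join_(s in S) s \in B -> \join_(s in S) s \in S.

(** For [y] not below [X], this says that [X] and [y] may occur together in a
    nested set, without asking them to be non-maximal in [B]. Maximal elements
    have to be allowed because they decide which elements of the contraction
    are maximal. *)
Definition compatible B X y : Prop := X `|` y \in B -> X <= y.

Lemma nestedW B N N' : N' \subset N -> nested B N -> nested B N'.
Proof. by move=> sub nest S SN'; apply/nest/(subset_trans SN'). Qed.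

Lemma join_greatest S x :
  x \in S -> {in S, forall s, s <= x} -> \join_(s in S) s \in S.
Proof.
move=> xS max_x; suff -> : \join_(s in S) s = x by [].
by apply/le_anti; rewrite (joins_sup _ xS) andbT; apply/joinsP.
Qed.

Lemma kappa_above S x : x \in S -> exists2 m, m \in kappa S & x <= m.
Proof.
move=> xS.
pose P m := (m \in S) && (x <= m).
have Px : P x by rewrite /P xS lexx.
(* The size of the principal ideal is a strictly increasing rank. *)
case: (@arg_maxnP L x P (fun m => #|[set y | y <= m]|) Px) => m /andP[mS xm] max_m.
exists m => //; rewrite inE mS /=; apply/forall_inP=> c cS; apply/implyP=> mc.
rewrite eq_sym eq_le mc /=.
have /max_m/= card_le : P c by rewrite /P cS (le_trans xm mc).
have sub : [set y | y <= m] \subset [set y | y <= c].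
  by apply/subsetP=> y; rewrite !inE => /le_trans; apply.
have/eqP/setP/(_ c) : [set y | y <= m] == [set y | y <= c].
  by rewrite eqEcard sub.
by rewrite !inE lexx.
Qed.

Lemma join_kappa S : \join_(s in kappa S) s = \join_(s in S) s.
Proof.
apply/le_anti/andP; split.
  by apply: le_joins; apply/subsetP=> x; rewrite inE => /andP[].
apply/joinsP=> s /kappa_above[m mk sm]; exact: (joins_min mk).
Qed.

Lemma kappa_antichain S : {in kappa S &, forall x y, x != y -> x >< y}.
Proof.
move=> x y; rewrite !inE => /andP[xS /forall_inP mx] /andP[yS /forall_inP my] nxy.
apply/negP=> /orP[xy|yx].
  by have /implyP/(_ xy) := mx y yS; rewrite eq_sym (negbTE nxy).
by have /implyP/(_ yx) := my x xS; rewrite (negbTE nxy).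
Qed.

Lemma nested_facesP B N : \bot \notin B ->
  reflect (N \subset B :\: kappa B /\ nested B N) (N \in nested_faces B).
Proof.
move=> bot; apply: (iffP idP) => [/imsetP[M]|[NB nest]].
  rewrite inE => /and3P[MB kM /forallP anti] ->; split; first exact: setSD.
  (* The maximal elements of [S] form an antichain with the same join. *)
  move=> S SN SB; rewrite -join_kappa; rewrite -join_kappa in SB.
  have kS : kappa S \subset S by apply/subsetP=> x; rewrite inE => /andP[].
  case: (ltngtP #|kappa S| 1) => [|gt1|/eqP/cards1P[m Em]].
  - by rewrite ltnS leqn0 cards_eq0 => /eqP E; rewrite E big_set0 (negbTE bot) in SB.
  - have /implyP/(_ _)/negP[] // := anti (kappa S).
    rewrite (subset_trans kS SN) gt1 /=.
    apply/forall_inP=> x xk; apply/forall_inP=> y yk; apply/implyP.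
    exact: (kappa_antichain xk yk).
  - by rewrite Em big_set1; apply: (subsetP kS); rewrite Em set11.
have NE : (N :|: kappa B) :\: kappa B = N.
  rewrite setDUl setDv setU0; apply/setDidPl.
  by move: NB; rewrite subsetD => /andP[].
apply/imsetP; exists (N :|: kappa B); rewrite ?NE // inE /nested_set subsetUr NE.
apply/and3P; split=> //.
  rewrite subUset (subset_trans NB (subsetDl _ _)).
  by apply/subsetP=> x; rewrite inE => /andP[].
apply/forallP=> S; apply/implyP=> /and3P[SN S2 /forall_inP anti].
apply/negP=> /(nest _ SN) top.
have [y] : exists y, y \in S :\ (\join_(s in S) s).
  by apply/set0Pn; rewrite -card_gt0; move: S2; rewrite (cardsD1 (\join_(s in S) s)) top.
rewrite !inE => /andP[ny yS].
have /forall_inP/(_ _ top)/implyP/(_ ny)/negP[] := anti y yS.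
by rewrite /Order.comparable (joins_sup _ yS).
Qed.

(** In product coordinates a [t <= D] is supported on the factor [D], so the
    tuple of the joins in the conclusion dominates every [t], hence also the top
    tuple. Compare the coordinates at [C]. *)
Lemma join_component Y S C : product_iso Y S -> forall T : {set L},
  (forall t, t \in T -> exists2 D, D \in S & t <= D) ->
  Y <= \join_(t in T) t -> C \in S -> C <= \join_(t in T | t <= C) t.
Proof.
case=> phi [_ phi_le phi_dfwith] T Tle TY CS.
have coordP (D : {D : L | D \in S}) :
    \join_(t in T | t <= val D) t \in below_pred (val D).
  by apply/joinsP=> t /andP[].
pose f : {dffun forall D : {D : L | D \in S}, below (val D)} :=
  finfun (fun D =>
    exist (fun y => y \in below_pred (val D)) _ (coordP D) : below (val D)).
pose g : {dffun forall D : {D : L | D \in S}, below (val D)} :=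
  finfun (fun D => \top : below (val D)).
have Yf : Y <= val (phi f).
  apply: (le_trans TY); apply/joinsP=> t tT; have [D DS tD] := Tle t tT.
  pose j : {D : L | D \in S} := exist _ D DS.
  have tj : t \in below_pred (val j) by [].
  pose u : below (val j) := exist (fun y => y \in below_pred (val j)) t tj.
  rewrite -[t]/(val u) -phi_dfwith Order.le_val phi_le.
  apply/forallP=> i; rewrite !ffunE; case: dfwithP => [|k _]; last exact: le0x.
  by rewrite -Order.le_val /=; apply: (@joins_sup _ _ _ t); rewrite tT.
have : phi g <= phi f by rewrite -Order.le_val (le_trans (valP (phi g)) Yf).
rewrite phi_le => /forallP/(_ (exist _ C CS)).
by rewrite !ffunE -Order.le_val.
Qed.

(** The elements of [S] below the component [C] that contains [b] have join [C],
    which is in [B], so nestedness puts [C] itself into [S]. *)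
Lemma le_join_nested B S b : building_set B -> S \subset B -> nested B S ->
  b \in B -> b <= \join_(s in S) s -> exists2 s, s \in S & b <= s.
Proof.
move=> [bot prod] SB nest bB bS; set Y := \join_(s in S) s in bS *.
have Y0 : \bot < Y.
  rewrite lt0x; apply: contraNneq bot => Y0.
  by rewrite -[\bot](@le_anti _ _ b) // -{1}Y0 bS le0x.
have /kappa_above[C CM bC] : b \in [set x in B | x <= Y] by rewrite inE bB.
have CB : C \in B by move: CM; rewrite !inE => /andP[/andP[]].
pose SC := [set s in S | s <= C].
have joinC : \join_(s in SC) s = C.
  apply/le_anti/andP; split; first by apply/joinsP=> s; rewrite inE => /andP[].
  under eq_bigl do rewrite inE.
  apply: (join_component (prod Y Y0)) => // s sS.
  by apply: kappa_above; rewrite inE (subsetP SB) //= joins_sup.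
have : C \in SC.
  rewrite -{1}joinC; apply: nest; last by rewrite joinC.
  by apply/subsetP=> s; rewrite inE => /andP[].
by rewrite inE => /andP[CS _]; exists C.
Qed.

End Nested.

(** * Splitting along an element of the building set *)

Section Split.
Context {d : Order.disp_t} {L : finTBLatticeType d}.
Context {B : {set L}} {X : L} (buildB : building_set B) (XB : X \in B).
Implicit Types (N S : {set L}) (b y : L).

Let botB : \bot \notin B := proj1 buildB.

Definition split_at (X y : L) : below X + above X :=
  if insub y is Some z then inl z else inr (join_above X y).

Lemma split_at_below (z : below X) : split_at X (val z) = inl z.
Proof. by rewrite /split_at valK. Qed.

Lemma split_at_above y : ~~ (y <= X) -> split_at X y = inr (join_above X y).
Proof. by move=> yX; rewrite /split_at insubN. Qed.

Lemma nested_pair y : (X `|` y \in B -> X >=< y) -> nested B [set X; y].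
Proof.
move=> comp S SXy SB.
have memS s : s \in S -> s = X \/ s = y.
  by move/(subsetP SXy); rewrite !inE => /orP[] /eqP; [left | right].
case XS: (X \in S); last first.
  have [S0|[s sS]] := set_0Vmem S.
    by move: SB; rewrite S0 big_set0 (negbTE botB).
  have onlyy t : t \in S -> t = y.
    by move=> tS; case: (memS t tS) => // tX; rewrite -tX tS in XS.
  by apply: (join_greatest sS) => t tS; rewrite (onlyy t tS) (onlyy s sS).
case yS: (y \in S); last first.
  apply: (join_greatest XS) => t tS; case: (memS t tS) => [->//|ty].
  by rewrite -ty tS in yS.
have SE : S = [set X] :|: [set y].
  apply/setP=> t; rewrite !inE; apply/idP/orP.
    by move/memS=> [] ->; rewrite eqxx; [left | right].
  by case=> /eqP->.
have /comp/orP[Xy|yX] : X `|` y \in B by rewrite SE joins_setU !big_set1 in SB.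
- by apply: (join_greatest yS) => t /memS[] ->.
- by apply: (join_greatest XS) => t /memS[] ->.
Qed.

(** Applied to compatible elements, this makes [y |-> y `|` X] reflect the order;
    in particular it is injective on them. *)
Lemma le_joinX y b : y \in B -> compatible B X y ->
  b \in B -> ~~ (b <= X) -> b <= y `|` X -> b <= y.
Proof.
move=> yB comp bB bX byX.
have XyB : [set X; y] \subset B by apply/subsetP=> s; rewrite !inE => /orP[] /eqP->.
have nest : nested B [set X; y].
  by apply: nested_pair => /comp Xy; rewrite /Order.comparable Xy.
have [] := le_join_nested buildB XyB nest bB.
  by rewrite joins_setU !big_set1 joinC.
by move=> s; rewrite !inE => /orP[] /eqP->; rewrite ?(negbTE bX).
Qed.

(** [b `|` X] is compatible with [X] if it lies in [B], and [b] is otherwise. *)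
Lemma compatible_representative b : b \in B -> ~~ (b <= X) ->
  exists y, [/\ y \in B, ~~ (y <= X), compatible B X y & y `|` X = b `|` X].
Proof.
move=> bB bX; case bXB: (b `|` X \in B).
  exists (b `|` X); split=> //.
  - by rewrite leUx negb_and bX.
  - by move=> _; rewrite leUr.
  - by rewrite -joinA joinxx.
by exists b; split=> //; rewrite /compatible joinC bXB.
Qed.

Lemma contractionP (c : above X) :
  reflect (exists y, [/\ y \in B, ~~ (y <= X), compatible B X y & c = join_above X y])
          (c \in contraction B X).
Proof.
apply: (iffP imsetP) => [[b]|[y [yB yX _ ->]]]; last by exists y; rewrite // inE yB.
rewrite inE => /andP[bB bX] ->.
have [y [yB yX comp yE]] := compatible_representative bB bX.
by exists y; split=> //; apply: val_inj; rewrite /= yE.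
Qed.

(** If the image of [y] is maximal, then a maximal [K] above [y] has the same
    image, so [K <= y `|` X] and [le_joinX] gives [K <= y]. Conversely, every
    element of the contraction is the image of a compatible [y'], and
    [y <= y' `|` X] forces [y <= y']. *)
Lemma kappa_contraction y : y \in B -> ~~ (y <= X) -> compatible B X y ->
  (join_above X y \in kappa (contraction B X)) = (y \in kappa B).
Proof.
move=> yB yX comp; apply/idP/idP.
  have [K Kmax yK] := kappa_above yB.
  have KB : K \in B by move: Kmax; rewrite inE => /andP[].
  have KX : ~~ (K <= X) by apply: contra yX; apply: le_trans.
  rewrite inE => /andP[_ /forall_inP/(_ (join_above X K))].
  have -> : join_above X K \in contraction B X by apply: imset_f; rewrite inE KB.
  move/(_ isT)/implyP; rewrite -Order.le_val /= leU2 //.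
  move=> /(_ isT)/eqP/(congr1 val)/= KyX.
  suff -> : y = K by [].
  by apply/le_anti; rewrite yK le_joinX // -KyX leUl.
move=> ymax; rewrite inE; apply/andP; split; first by apply/contractionP; exists y.
apply/forall_inP=> c /contractionP[y' [y'B y'X comp' ->]]; apply/implyP.
rewrite -Order.le_val /= => le_yy'.
have yy' : y <= y' by apply: le_joinX => //; apply: le_trans le_yy'; rewrite leUl.
by move: ymax; rewrite inE => /andP[_ /forall_inP/(_ y' y'B)/implyP/(_ yy')/eqP->].
Qed.

Lemma bot_restriction : \bot \notin restriction B X.
Proof. by rewrite inE. Qed.

Lemma bot_contraction : \bot \notin contraction B X.
Proof.
apply/imsetP=> -[b]; rewrite inE => /andP[_ /negP bX] /(congr1 val)/= XE.
by apply: bX; rewrite XE leUl.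
Qed.

Lemma restrictionD_kappa (z : below X) :
  (z \in restriction B X :\: kappa (restriction B X)) = (val z \in B) && (val z != X).
Proof.
rewrite !inE; case zB: (val z \in B); rewrite ?andbF //= andbT; congr negb.
apply/idP/eqP => [/forall_inP/(_ \top)|zX].
  by rewrite inE => /(_ XB)/implyP/(_ (lex1 _))/eqP <-.
have -> : z = \top by apply: val_inj; exact: zX.
by apply/forall_inP=> c _; rewrite eq_le lex1 implybb.
Qed.

Lemma val_join_below (S : {set below X}) :
  val (\join_(s in S) s) = \join_(s in val @: S) s.
Proof.
rewrite big_imset /=; last by move=> ? ? _ _; apply: val_inj.
by apply: (big_morph val) => // x y; rewrite omorphU.
Qed.

(** [X] enters the right-hand side because the empty join in [above X] is [X]. *)
Lemma val_join_above S :
  val (\join_(t in join_above X @: S) t) = \join_(s in X |: S) s.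
Proof.
apply/le_anti/andP; split.
  have XS : \join_(s in X |: S) s \in above_pred X by apply: joins_sup; rewrite setU11.
  change (val (\join_(t in join_above X @: S) t) <=
    val (exist (fun y => y \in above_pred X) _ XS : above X)).
  rewrite Order.le_val; apply/joinsP=> _ /imsetP[s sS ->]; rewrite -Order.le_val /=.
  by rewrite leUx !joins_sup // ?setU11 // setU1r.
apply/joinsP=> s /setU1P[->|sS]; last first.
  apply: (@le_trans _ _ (val (join_above X s))); first exact: leUl.
  by rewrite Order.le_val; apply: (joins_sup id); apply: imset_f.
by have := above_le0x (\join_(t in join_above X @: S) t); rewrite -Order.le_val.
Qed.

Lemma nested_split N : N \subset B ->
  {in N, forall y, ~~ (y <= X) -> compatible B X y} ->
  nested B (X |: N) <->
  nested (restriction B X) [set z | val z \in N] /\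
  nested (contraction B X) [set join_above X y | y in N & ~~ (y <= X)].
Proof.
move=> NB comp; have XNB : X |: N \subset B by rewrite subUset sub1set XB.
split=> [nest|[nestr nestc] S SXN SB].
  split=> [S SN|T TN].
    rewrite inE val_join_below => /nest.
    rewrite -val_join_below mem_imset; last exact: val_inj.
    apply; apply: subset_trans (subsetUr _ _); apply/subsetP=> _ /imsetP[z zS ->].
    by have := subsetP SN z zS; rewrite inE.
  pose S := [set y in N | ~~ (y <= X) & join_above X y \in T].
  have TE : T = join_above X @: S.
    apply/setP=> t; apply/idP/imsetP=> [tT|[y + ->]]; last by rewrite inE => /and3P[].
    have /imsetP[y] := subsetP TN t tT; rewrite inE => /andP[yN yX] tE.
    by exists y => //; rewrite inE yN yX -tE.
  have SN : X |: S \subset X |: N.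
    by apply/setUS/subsetP=> y; rewrite inE => /andP[].
  case/imsetP=> b; rewrite inE => /andP[bB bX] joinT.
  have joinS : b `|` X = \join_(s in X |: S) s by rewrite -val_join_above -TE joinT.
  have [|s + bs] := le_join_nested buildB (subset_trans SN XNB) (nestedW SN nest) bB.
    by rewrite -joinS leUl.
  case/setU1P=> [sX|]; first by rewrite -sX bs in bX.
  rewrite inE => /and3P[sN sX sT]; suff -> : \join_(t in T) t = join_above X s by [].
  apply/le_anti; rewrite (joins_sup id) // andbT joinT -Order.le_val /=; exact: leU2.
(* From here on, [S] is a subset of [X |: N] whose join is in [B]. *)
have inN y : y \in S -> ~~ (y <= X) -> y \in N.
  by move=> /(subsetP SXN)/setU1P[->|//]; rewrite lexx.
have [SX|] := boolP [forall y in S, y <= X].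
  have {}SX : {in S, forall y, y <= X} by apply/forall_inP.
  case XS: (X \in S); first exact: (join_greatest XS).
  pose S' : {set below X} := [set z | val z \in S].
  have SE : S = val @: S'.
    apply/setP=> y; apply/idP/imsetP=> [yS|[z + ->]]; last by rewrite inE.
    exists (exist (fun y => y \in below_pred X) y (SX y yS) : below X) => //.
    by rewrite inE.
  rewrite SE -val_join_below mem_imset; last exact: val_inj.
  apply: nestr; last by rewrite inE val_join_below -SE.
  apply/subsetP=> z; rewrite !inE => zS.
  by move: (subsetP SXN _ zS) => /setU1P[zX|//]; rewrite zX XS in zS.
rewrite negb_forall_in => /exists_inP[y0 y0S y0X].
(* The elements of [S] below [X] are absorbed when the join is taken with [X]. *)
pose S2 := [set y in S | ~~ (y <= X)]; pose T := join_above X @: S2.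
have joinT : val (\join_(t in T) t) = (\join_(s in S) s) `|` X.
  rewrite val_join_above joins_setU big_set1; apply/le_anti/andP; split.
    rewrite leUx leUr /=; apply/joinsP=> s; rewrite inE => /andP[sS _].
    by apply: lexUl; apply: joins_sup.
  rewrite leUx leUl andbT; apply/joinsP=> s sS.
  have [sX|sX] := boolP (s <= X); first exact: lexUl.
  by apply: lexUr; apply: joins_sup; rewrite inE sS.
have joinX : ~~ (\join_(s in S) s <= X).
  by apply: contra y0X; apply: le_trans; apply: joins_sup.
have /imsetP[y] : \join_(t in T) t \in T.
  apply: nestc.
    apply/subsetP=> _ /imsetP[y + ->]; rewrite inE => /andP[yS yX].
    by apply: imset_f; rewrite inE inN.
  by apply/imsetP; exists (\join_(s in S) s); [rewrite inE SB | apply: val_inj].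
rewrite inE => /andP[yS yX] joinE; apply: (join_greatest yS) => s sS.
have yN := inN y yS yX.
apply: (@le_trans _ _ (\join_(s in S) s)); first exact: joins_sup.
apply: le_joinX => //; [exact: (subsetP NB) | exact: comp |].
by move: (congr1 val joinE); rewrite joinT /= => <-; rewrite leUl.
Qed.

End Split.

(** * Isomorphisms and joins of complexes *)

Section Complexes.
Context {T T' : finType} (D : complex T) (D' : complex T').

Lemma join_facesE (t : {set T + T'}) :
  (t \in faces (join_complex D D')) =
  (inl @^-1: t \in faces D) && (inr @^-1: t \in faces D').
Proof.
apply/imset2P/andP => [[s s' sD s'D' ->]|[sD s'D']].
  split; [rewrite (_ : _ @^-1: _ = s)|rewrite (_ : _ @^-1: _ = s')] => //;
    apply/setP=> x; rewrite !inE; apply/orP/idP.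
  - by case=> /imsetP[y ys // [->]].
  - by move=> xs; left; apply: imset_f.
  - by case=> /imsetP[y ys // [->]].
  - by move=> xs; right; apply: imset_f.
exists (inl @^-1: t) (inr @^-1: t) => //; apply/setP=> z; rewrite inE.
apply/idP/orP=> [|[] /imsetP[y + ->]]; last 2 first.
- by rewrite inE.
- by rewrite inE.
by case: z => z zt; [left | right]; apply: imset_f; rewrite inE.
Qed.

(** Injectivity and covering suffice for a bijection on vertices: singletons are
    faces exactly when their images are, and the covering bounds the number of
    vertices of [D'], so that finiteness gives surjectivity. *)
Lemma complex_iso_imset (g : T -> T') :
  {in vertices D &, injective g} -> vertices D' \subset g @: vertices D ->
  (forall s : {set T}, s \subset vertices D -> (s \in faces D) = (g @: s \in faces D')) ->
  complex_iso D D'.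
Proof.
move=> injg surjg facesg.
have gV (x : {x | x \in vertices D}) : g (val x) \in vertices D'.
  by have := valP x; rewrite !inE facesg ?imset_set1 // sub1set; exact: valP.
pose f (x : {x | x \in vertices D}) : {y | y \in vertices D'} :=
  exist (fun y => y \in vertices D') _ (gV x).
exists f; split.
  apply: inj_card_bij => [x y /(congr1 val)/= E|].
    by apply: val_inj; apply: injg => //; apply: valP.
  rewrite !card_sig; apply: leq_trans (leq_imset_card g _).
  exact: (subset_leq_card surjg).
move=> s; rewrite facesg; last by apply/subsetP=> _ /imsetP[x _ ->]; exact: valP.
by rewrite -imset_comp.
Qed.

End Complexes.

(** * The link of a vertex of the nested complex *)

Section LinkOfVertex.
Context {d : Order.disp_t} {L : finTBLatticeType d}.
Context {B : {set L}} {X : L} (buildB : building_set B) (XD : X \in B :\: kappa B).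
Implicit Types (N S : {set L}) (b y : L).

Let botB : \bot \notin B := proj1 buildB.
Let XB : X \in B. Proof. by have /setDP[] := XD. Qed.

Let D := link (nested_complex B) [set X].
Let D' := join_complex (nested_complex (restriction B X))
                       (nested_complex (contraction B X)).

Lemma link_facesP N :
  reflect [/\ X \notin N, N \subset B :\: kappa B & nested B (X |: N)] (N \in faces D).
Proof.
rewrite inE [_ :&: _ == _](_ : _ = (X \notin N)); last first.
  by rewrite setI_eq0 disjoints1.
apply: (iffP and3P) => [[_ XN /(nested_facesP _ botB)[]]|[XN NBk nest]].
  by rewrite subUset => /andP[].
have XNBk : X |: N \subset B :\: kappa B by rewrite subUset sub1set XD.
split=> //; apply/(nested_facesP _ botB); split=> //.
exact: nestedW (subsetUr _ _) nest.
Qed.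

Lemma vertex_link y :
  reflect [/\ y \in B :\: kappa B, y != X & ~~ (y <= X) -> compatible B X y]
          (y \in vertices D).
Proof.
rewrite [y \in vertices _]inE; apply: (iffP (link_facesP _)).
  rewrite in_set1 sub1set eq_sym => -[yX yB nest]; split=> // nyX XyB.
  have := nest [set X; y] (subxx _).
  (* The join of [X] and [y] must be attained, at [X] or at [y]. *)
  rewrite joins_setU !big_set1 => /(_ XyB); rewrite !inE => /orP[] /eqP XyE.
    by rewrite -XyE leUr in nyX.
  by rewrite -XyE leUl.
case=> yB yX comp; rewrite in_set1 eq_sym sub1set; split=> //.
apply: nested_pair => // XyB; apply/orP.
by have [|/comp/(_ XyB)] := boolP (y <= X); [right | left].
Qed.

Lemma split_at_inj : {in vertices D &, injective (split_at X)}.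
Proof.
move=> y y' /vertex_link[/setDP[yB _] _ comp] /vertex_link[/setDP[y'B _] _ comp'].
rewrite /split_at.
case: insubP => [z _ <-|yX]; case: insubP => [z' _ <-|y'X] => //; first by case=> ->.
move=> E0; have /= E := congr1 val (inr_inj E0); apply/le_anti/andP; split.
- by apply: (le_joinX buildB XB y'B (comp' y'X)); rewrite // -E leUl.
- by apply: (le_joinX buildB XB yB (comp yX)); rewrite // E leUl.
Qed.

Lemma split_at_surj : vertices D' \subset split_at X @: vertices D.
Proof.
apply/subsetP=> -[z|c]; rewrite inE join_facesE => /andP[].
  move=> + _; rewrite (_ : _ @^-1: _ = [set z]); last by apply/setP=> x; rewrite !inE.
  case/(nested_facesP _ (bot_restriction buildB)); rewrite sub1set restrictionD_kappa //.
  move=> /andP[zB zX] _; have le_zX : val z <= X := valP z.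
  rewrite -split_at_below; apply/imset_f/vertex_link; split=> //; last by rewrite le_zX.
  rewrite inE zB andbT inE zB /=; apply/negP=> /forall_inP/(_ X XB)/implyP/(_ le_zX).
  by rewrite eq_sym (negbTE zX).
move=> _; rewrite (_ : _ @^-1: _ = [set c]); last by apply/setP=> x; rewrite !inE.
case/(nested_facesP _ bot_contraction); rewrite sub1set => /setDP[cC ck] _.
have /contractionP[y [yB yX comp cE]] := cC.
rewrite cE -split_at_above //; apply/imset_f/vertex_link; split=> //.
  by rewrite inE yB -(kappa_contraction buildB XB) // -cE ck.
by apply: contraNneq yX => ->.
Qed.

Lemma split_at_faces N : N \subset vertices D ->
  (N \in faces D) = (split_at X @: N \in faces D').
Proof.
move=> NV.
have vN y : y \in N ->
    [/\ y \in B :\: kappa B, y != X & ~~ (y <= X) -> compatible B X y].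
  by move/(subsetP NV)/vertex_link.
have NB : N \subset B by apply/subsetP=> y /vN[/setDP[]].
rewrite join_facesE.
have -> : inl @^-1: (split_at X @: N) = [set z | val z \in N].
  apply/setP=> z; rewrite !inE; apply/imsetP/idP=> [[y yN]|zN]; last first.
    by exists (val z); rewrite ?split_at_below.
  by rewrite /split_at; case: insubP => // z' _ z'y [->]; rewrite z'y.
have -> : inr @^-1: (split_at X @: N) = [set join_above X y | y in N & ~~ (y <= X)].
  apply/setP=> c; rewrite inE; apply/imsetP/imsetP=> [[y yN]|[y]].
    rewrite /split_at; case: insubP => // yX [->].
    by exists y => //; rewrite inE yN.
  by rewrite inE => /andP[yN yX] ->; exists y; rewrite ?split_at_above.
have comp : {in N, forall y, ~~ (y <= X) -> compatible B X y}.
  by move=> y /vN[].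
apply/link_facesP/andP => [[_ _ /(nested_split buildB XB NB comp)[nestr nestc]]|].
  split.
    apply/(nested_facesP _ (bot_restriction buildB)); split=> //.
    apply/subsetP=> z; rewrite inE => /vN[/setDP[zB _] zX _].
    by rewrite restrictionD_kappa // zB.
  apply/(nested_facesP _ bot_contraction); split=> //.
  apply/subsetP=> _ /imsetP[y + ->]; rewrite inE => /andP[yN yX].
  have [/setDP[yB yk] _ _] := vN y yN.
  by rewrite inE (kappa_contraction buildB XB) ?yk /= ?imset_f ?inE ?yB //; apply: comp.
case=> /(nested_facesP _ (bot_restriction buildB))[_ nestr].
case/(nested_facesP _ bot_contraction) => _ nestc; split.
- by apply/negP=> /vN[]; rewrite eqxx.
- by apply/subsetP=> y /vN[].
- by apply/(nested_split buildB XB NB comp).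
Qed.

End LinkOfVertex.

Theorem proposition2p41 (d : Order.disp_t) (L : finTBLatticeType d)
    (B : {set L}) (HB : building_set B) (X : L) (HX : X \in B :\: kappa B) :
  complex_iso (link (nested_complex B) [set X])
              (join_complex (nested_complex (restriction B X))
                            (nested_complex (contraction B X))).
Proof.
apply: (complex_iso_imset (split_at_inj HB HX) (split_at_surj HB HX)).
exact: split_at_faces.
Qed.
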